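(* Let $(\mathcal{H},W)$ be a weighted directed hypernetwork with $n$ cells $C$ and hyperedges $E$, and let $\mathcal{D}_{\mathcal{H}}$ be its associated incidence digraph. A polydiagonal subspace $\Delta$ is a synchrony subspace for the hypernetwork $(\mathcal{H},W)$ if and only if $\Delta=\Delta_{\tilde{\bowtie}_{\mathcal{H}}}$ for some equivalence relation $\tilde{\bowtie}$ on $C\cup E$ such that $\Delta_{\tilde{\bowtie}}$ is a synchrony subspace of the adjacency matrix of the digraph $\mathcal{D}_{\mathcal{H}}$.
   Context: Directed hypergraphs. A directed hypergraph $\mathcal{H}=(C,E)$ consists of a finite set $C=\{1,\dots,n\}$ of nodes (cells) and a finite set $E=\{e_1,\dots,e_m\}$ of directed hyperedges; a directed hyperedge is a pair $e=(T(e),H(e))$ where the tail $T(e)$ is a nonempty multiset of elements of $C$ and the head $H(e)$ is a nonempty subset of $C$; $\#T(e)$ is counted with multiplicity. Each $e$ has a real weight $w_e$; the weight matrix $W\in\mathbb{R}^{n\times m}$ has $(i,j)$ entry $w_{e_j}$ if $i\in H(e_j)$ and $0$ otherwise. All hypergraphs have nonempty node and hyperedge sets and are weakly connected. Hypernetworks. A hypernetwork is a weighted directed hypergraph $(\mathcal{H},W)$ in which every node has the same phase space $V=\mathbb{R}^d$ and the same (smooth) internal dynamics $f:V\to V$. Let $BS_k(c)=\{e\in E:c\in H(e),\ \#T(e)=k\}$, $B(c)=\{k:BS_k(c)\neq\emptyset\}$, $B(\mathcal{H})=\bigcup_cB(c)$. A family $Q=(Q_k)_{k\in\mathbb{N}}$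 of smooth functions $Q_k:V^{k+1}\to V$, each invariant under permutations of its last $k$ arguments, is admissible if $Q_k\neq0$ for $k\in B(\mathcal{H})$ and $Q_k=0$ otherwise. The admissible cell vector fields are $F_i(x)=f(x_i)+\sum_{k\in B(i)}\sum_{e\in BS_k(i)}w_eQ_k(x_i;x_{T(e)})$, $i\in C$, where $x_{T(e)}$ lists the variables $x_j$, $j\in T(e)$, with multiplicity. Synchrony subspaces. A polydiagonal subspace is a subspace defined by equalities of cell coordinates; for an equivalence relation $\bowtie$ on $C$ write $\Delta_{\bowtie}=\{x\in V^n: x_c=x_{c'}\text{ if }c\bowtie c'\}$. A polydiagonal subspace is a synchrony subspace for $(\mathcal{H},W)$ if it is left invariant under the flow of $\dot x_i=F_i(x)$ for all admissible cell vector fields, for every hypernetwork on $(\mathcal{H},W)$ (every choice of $V$ and $f$). A polydiagonal subspace of $\mathbb{R}^N$ is a synchrony subspace of an $N\times N$ real matrix $K$ if $K$ leaves it invariant. Incidence digraph. $\mathcal{D}_{\mathcal{H}}$ is the weighted bipartite digraph with node set $C\cup E$, with an edge from $i\in C$ to $e_j$ of weight equal to the multiplicity of $i$ in $T(e_j)$ iff $i\in T(e_j)$, and an edge from $e_j$ to $i$ of weight $w_{e_j}$ iff $i\in H(e_j)$. Its adjacency matrix is $\begin{pmatrix} 0_{n\times n} & W \\ T & 0_{m\times m} \end{pmatrix}$, where $T_{ji}$ is the multiplicity of $i$ in $T(e_j)$. Relations. For an equivalence relation $\tilde{\bowtie}$ on $C\cup E$, the nodes of $\mathcal{D}_{\mathcal{H}}$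 having phase space $\mathbb{R}$, put $\Delta_{\tilde{\bowtie}}=\{x_c=x_{c'}\text{ if }c\,\tilde{\bowtie}\,c'\ (c,c'\in C),\ x_e=x_{e'}\text{ if }e\,\tilde{\bowtie}\,e'\ (e,e'\in E)\}\subseteq\mathbb{R}^{n+m}$. The projection $\tilde{\bowtie}_{\mathcal{H}}$ on $C$ is given by $c\,\tilde{\bowtie}_{\mathcal{H}}\,c'$ iff $c\,\tilde{\bowtie}\,c'$, for $c,c'\in C$, and $\Delta_{\tilde{\bowtie}_{\mathcal{H}}}$ is the corresponding polydiagonal subspace on the cells $C$. *)

(* Defs.v *)
From HB Require Import structures.
From mathcomp Require Import all_boot all_order all_fingroup all_algebra.
From mathcomp Require Import finmap multiset.
From mathcomp Require Import all_classical all_reals all_analysis.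

Set Implicit Arguments.
Unset Strict Implicit.
Unset Printing Implicit Defensive.

Import Order.TTheory GRing.Theory Num.Theory.
Import numFieldNormedType.Exports.

Local Open Scope classical_set_scope.
Local Open Scope ring_scope.

(* Cells are 'I_n.  The hyperedges e_1, ..., e_m form a set of pairs
   (tail, head), so the enumeration [edge] is injective. *)
Record hypergraph (n m : nat) := Hypergraph {
  edge : 'I_m -> {mset 'I_n}%mset * {set 'I_n};
  edge_inj : injective edge;
  tail_neq0 : forall e, (edge e).1 != mset0;
  head_neq0 : forall e, (edge e).2 != finset.set0;
  cells_gt0 : (0 < n)%N;
  hyperedges_gt0 : (0 < m)%N
}.

Section HypergraphCombinatorics.
Context {n m : nat} (H : hypergraph n m).

Definition tail (e : 'I_m) : {mset 'I_n}%mset := (edge H e).1.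
Definition head (e : 'I_m) : {set 'I_n} := (edge H e).2.

(* #T(e), counted with multiplicity *)
Definition tail_size (e : 'I_m) : nat := size (tail e : seq 'I_n).

Definition incident (c : 'I_n) (e : 'I_m) : bool :=
  (c \in tail e) || (c \in head e).

Definition neighbours : rel 'I_n :=
  [rel c c' | [exists e, incident c e && incident c' e]].

Definition weakly_connected : Prop := forall c c' : 'I_n, connect neighbours c c'.

Definition BS (k : nat) (c : 'I_n) : {set 'I_m} :=
  [set e | (c \in head e) && (tail_size e == k)]%SET.

(* B(c) as a duplicate-free list; the bound on k loses no element. *)
Definition B (c : 'I_n) : seq nat :=
  [seq k <- iota 0 (\max_e tail_size e).+1 | BS k c != finset.set0].

Definition in_BH (k : nat) : bool := [exists c, k \in B c].

End HypergraphCombinatorics.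

Section Dynamics.
Context {R : realType}.

Fixpoint Cn {U V : normedModType R} (k : nat) (f : U -> V) : Prop :=
  match k with
  | 0 => continuous f
  | k'.+1 => (forall x, differentiable f x) /\ (forall v, Cn k' ('D_v f))
  end.

Definition smooth {U V : normedModType R} (f : U -> V) : Prop :=
  forall k, Cn k f.

(* Any t in the interval of existence of a solution lies in a bounded open
   subinterval around 0, so bounded intervals suffice. *)
Definition flow_invariant {X : normedModType R} (F : X -> X) (D : set X) :
    Prop :=
  forall (a b : R) (x : R -> X), a < 0 -> 0 < b ->
    (forall t, t \in `]a, b[ -> is_derive t 1 x (F (x t))) ->
    D (x 0) -> forall t, t \in `]a, b[ -> D (x t).

(* A point of V^N, V = R^d, is an N x d matrix whose i-th row is the i-th
   coordinate. *)
Definition polydiag {N : nat} (r : rel 'I_N) (d : nat) : set 'M[R]_(N, d) :=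
  [set x : 'M[R]_(N, d) | forall i j, r i j -> row i x = row j x].
Arguments polydiag {N} r d _.

Definition mx_synchrony_subspace {N : nat} (K : 'M[R]_N) (D : set 'cV[R]_N) :
    Prop :=
  (exists r : rel 'I_N, equivalence_rel r /\ D = polydiag r 1) /\
  (forall x, D x -> D (K *m x)).

Context {n m : nat} (H : hypergraph n m) (w : 'I_m -> R).

(* V^(k+1): row 0 is the state of the cell, the other k rows are its inputs. *)
Definition coupling (d : nat) : Type :=
  forall k : nat, 'M[R]_(1 + k, d) -> 'rV[R]_d.

Section CellVectorField.
Context {d : nat}.

Definition admissible (Q : coupling d) : Prop :=
  [/\ forall k, smooth (Q k),
      forall k (s : 'S_k) (y : 'rV[R]_d) (z : 'M[R]_(k, d)),
        Q k (col_mx y (row_perm s z)) = Q k (col_mx y z),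
      forall k, in_BH H k -> Q k <> cst 0
    & forall k, ~~ in_BH H k -> Q k = cst 0].

(* x_{T(e)}, for #T(e) = k; then the default value i of nth is never used. *)
Definition tail_states (x : 'M[R]_(n, d)) (i : 'I_n) (e : 'I_m) (k : nat) :
    'M[R]_(k, d) :=
  \matrix_(a < k) row (nth i (tail H e) a) x.

Definition cell_vf (f : 'rV[R]_d -> 'rV[R]_d) (Q : coupling d)
    (x : 'M[R]_(n, d)) : 'M[R]_(n, d) :=
  \matrix_(i < n)
    (f (row i x) + \sum_(k <- B H i) \sum_(e in BS H k i)
       w e *: Q k (col_mx (row i x) (tail_states x i e k))).

End CellVectorField.

(* A polydiagonal subspace is presented by its equivalence relation, since it
   has to be considered in V^n for every phase space V = R^d. *)
Definition synchrony_subspace (r : rel 'I_n) : Prop :=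
  forall (d : nat) (f : 'rV[R]_d -> 'rV[R]_d) (Q : coupling d),
    (0 < d)%N -> smooth f -> admissible Q ->
    flow_invariant (cell_vf f Q) (polydiag r d).

Definition weight_mx : 'M[R]_(n, m) :=
  \matrix_(i, j) (if i \in head H j then w j else 0).

Definition tail_mx : 'M[R]_(m, n) := \matrix_(j, i) (tail H j i)%:R.

Definition incidence_adj : 'M[R]_(n + m) := block_mx 0 weight_mx tail_mx 0.

(* Only the relations between two cells and between two hyperedges count: the
   subspace does not see a cell being related to a hyperedge. *)
Definition polydiag_incidence (r : rel ('I_n + 'I_m)) : set 'cV[R]_(n + m) :=
  [set x : 'cV[R]_(n + m) |
    (forall c c', r (inl c) (inl c') ->
       x (lshift m c) 0 = x (lshift m c') 0) /\
    (forall e e', r (inr e) (inr e') ->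
       x (rshift n e) 0 = x (rshift n e') 0)].

End Dynamics.

Arguments polydiag {R N} r d _.

Definition cell_proj {n m : nat} (r : rel ('I_n + 'I_m)) : rel 'I_n :=
  [rel c c' | r (inl c) (inl c')].

(* Main.v *)
Require Import Defs.
From HB Require Import structures.
From mathcomp Require Import all_boot all_order all_fingroup all_algebra.
From mathcomp Require Import finmap multiset.
From mathcomp Require Import all_classical all_reals all_analysis.
From mathcomp Require Import ring lra.

Set Implicit Arguments.
Unset Strict Implicit.
Unset Printing Implicit Defensive.

Import Order.TTheory GRing.Theory Num.Theory.
Import numFieldNormedType.Exports.

Local Open Scope classical_set_scope.
Local Open Scope ring_scope.

(** Both sides amount to the existence of a hyperedge relation q that satisfies,
    together with the cell relation r, two finite conditions: hyperedges related
    by q have, for every class of r, the same number of tail cells in that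
    class, and cells related by r receive the same total weight from every class
    of q.  Invariance of the polydiagonal subspace under the adjacency matrix is
    this pair of conditions written linearly ([incidence_synchronyP],
    [tail_equiv_sum]).

    If the two conditions hold, an admissible vector field F maps the
    polydiagonal subspace D into itself: on D, hyperedges related by q send the
    same input to a given cell, because their tail states differ by a
    permutation only ([cell_vf_polydiag]).  That a solution starting in D stays
    in D is then a matter of uniqueness for ordinary differential equations.
    Write P for the projection onto D that copies the state of the chosen
    representative of each class.  The function z = x - P x satisfies
    |z'| <= 2 k |z| near any time at which z vanishes, since F is locally
    Lipschitz, F (P x) = P (F (P x)) and P does not increase the norm.
    Gronwall's inequality makes the zero set of z open, and connectedness of
    the interval of existence finishes the argument
    ([polydiag_flow_invariant]).

    Conversely, take for q the relation of having as many tail cells in every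
    class of r.  Flow invariance only speaks of solutions, and no existence
    theorem is needed if the phase space is R^2 and the vector field feeds a
    polynomial h of the sum of the first coordinates of the inputs into the
    second coordinate: the first coordinates are then constant in time and the
    solutions are affine, so that F itself must preserve D ([synchrony_probe]).
    Let the first coordinate of a cell be N ^ j, where j is the representative
    of its class and N exceeds all tail sizes.  By uniqueness of base-N
    expansions the sum over a tail determines the q-class of the hyperedge, and
    choosing h to vanish at the sums of all the other classes isolates the
    weights that come from one class ([synchrony_tail_class]). *)

(** * Entries and norm of a matrix *)

Section MatrixNorm.
Context {R : realType} {p q : nat}.
Implicit Types A : 'M[R]_(p, q).

Lemma ler_mx_entry A i j : `|A i j| <= `|A|.
Proof.
rewrite [leRHS]/Num.Def.normr/= mx_normrE.
exact: (le_bigmax _ (fun ij : 'I_p * 'I_q => `|A ij.1 ij.2|) (i, j)).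
Qed.

Lemma mx_norm_le A (c : R) :
  0 <= c -> (forall i j, `|A i j| <= c) -> `|A| <= c.
Proof.
move=> c0 Ac; rewrite [leLHS]/Num.Def.normr/= mx_normrE.
by apply: bigmax_le => // -[i j] _; exact: Ac.
Qed.

End MatrixNorm.

(** * Locally Lipschitz maps *)

Section LocallyLipschitz.
Context {R : realType}.

(** [g] is Lipschitz on some neighbourhood of [x].  The constant is required to
    be nonnegative, which matters only when [U] is trivial, and spares side
    conditions when constants are multiplied. *)
Definition locally_lipschitz {U V : normedModType R} (g : U -> V) (x : U) :=
  exists2 k : R, 0 <= k &
    \forall z \near (x, x), `|g z.1 - g z.2| <= k * `|z.1 - z.2|.

Lemma locally_lipschitz_cst {U V : normedModType R} (c : V) (x : U) :
  locally_lipschitz (fun=> c) x.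
Proof.
by exists 0 => //; near=> z; rewrite subrr normr0 mul0r.
Unshelve. all: by end_near. Qed.

Lemma locally_lipschitzD {U V : normedModType R} (f g : U -> V) x :
  locally_lipschitz f x -> locally_lipschitz g x ->
  locally_lipschitz (fun y => f y + g y) x.
Proof.
move=> [k k0 fk] [l l0 gl]; exists (k + l); first exact: addr_ge0.
near=> z; rewrite opprD addrACA mulrDl (le_trans (ler_normD _ _))// lerD//.
- by near: z.
- by near: z.
Unshelve. all: by end_near. Qed.

Lemma locally_lipschitz_sum {U V : normedModType R} (I : Type) (s : seq I)
    (P : pred I) (f : I -> U -> V) x :
  (forall i, locally_lipschitz (f i) x) ->
  locally_lipschitz (fun y => \sum_(i <- s | P i) f i y) x.
Proof.
move=> fx; elim: s => [|i s IHs].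
  under [X in locally_lipschitz X]eq_fun do rewrite big_nil.
  exact: locally_lipschitz_cst.
under [X in locally_lipschitz X]eq_fun do rewrite big_cons.
by case: (P i) => //; exact: locally_lipschitzD.
Qed.

Lemma locally_lipschitzZ {U V : normedModType R} (c : R) (f : U -> V) x :
  locally_lipschitz f x -> locally_lipschitz (fun y => c *: f y) x.
Proof.
move=> [k k0 fk]; exists (`|c| * k); first by rewrite mulr_ge0.
near=> z; rewrite -scalerBr normrZ -mulrA ler_wpM2l//; near: z; exact: fk.
Unshelve. all: by end_near. Qed.

(** [L] is typically a map that selects, and possibly repeats, coordinates. *)
Lemma locally_lipschitz_comp1 {U V W : normedModType R} (f : V -> W)
    (L : U -> V) x :
  (forall y z, `|L y - L z| <= `|y - z|) ->
  locally_lipschitz f (L x) -> locally_lipschitz (f \o L) x.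
Proof.
move=> L1 [k k0 /nbhs_ballP[e /= e0 fk]]; exists k => //.
have Lball y : ball x e y -> ball (L x) e (L y).
  by rewrite -!ball_normE; exact/le_lt_trans.
apply/nbhs_ballP; exists e => //= -[y z] [/= xy xz].
have /= := fk (L y, L z) (conj (Lball _ xy) (Lball _ xz)).
by move/le_trans; apply; rewrite ler_wpM2l.
Qed.

Lemma locally_lipschitz_mx {U : normedModType R} {p q : nat}
    (f : U -> 'M[R]_(p, q)) x :
  (forall i, locally_lipschitz (fun y => row i (f y)) x) ->
  locally_lipschitz f x.
Proof.
move=> fx.
have {}fx i : exists k : R, 0 <= k /\
    \forall z \near (x, x),
      `|row i (f z.1) - row i (f z.2)| <= k * `|z.1 - z.2|.
  by have [k] := fx i; exists k.
have [k /all_and2[k0 fk]] := choice fx.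
exists (\sum_i k i); first by rewrite sumr_ge0.
near=> z; apply: mx_norm_le => [|i j].
  by rewrite mulr_ge0// sumr_ge0.
have -> : (f z.1 - f z.2) i j = (row i (f z.1) - row i (f z.2)) 0 j.
  by rewrite !mxE.
apply: (le_trans (ler_mx_entry _ _ _)).
apply: (@le_trans _ _ (k i * `|z.1 - z.2|)).
  move: i; near: z; apply: filter_forall => i; exact: fk.
by rewrite ler_wpM2r// (bigD1 i)//= lerDl sumr_ge0.
Unshelve. all: by end_near. Qed.

(** The directional derivatives along the canonical basis are bounded on a ball
    around [x]; the mean value theorem is applied to each entry of [g] along
    the segment between two points of that ball. *)
Lemma C1_locally_lipschitz {p q r s : nat}
    (g : 'M[R]_(p, q) -> 'M[R]_(r, s)) x :
  Cn 1 g -> locally_lipschitz g x.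
Proof.
move=> [dg cDg].
pose M (k : 'I_p) (l : 'I_q) := `|'D_(delta_mx k l) g x| + 1.
have M0 k l : 0 <= M k l by rewrite addr_ge0.
exists (\sum_k \sum_l M k l); first by do 2!apply: sumr_ge0 => ? _.
have : \forall y \near x, forall kl : 'I_p * 'I_q,
    `|'D_(delta_mx kl.1 kl.2) g y| <= M kl.1 kl.2.
  pose P kl y := `|'D_(delta_mx kl.1 kl.2) g y| <= M kl.1 kl.2.
  apply: (@filter_forall _ _ P (nbhs x)) => -[k l]; rewrite /P /=.
  have /cvgr_dist_lt/(_ _ ltr01) := cDg (delta_mx k l) x.
  apply: filterS => y yk.
  rewrite -(subrK ('D_(delta_mx k l) g x) ('D_(delta_mx k l) g y)).
  by rewrite /M addrC (le_trans (ler_normD _ _))// lerD2l distrC ltW.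
move=> /nbhs_ballP[e /= e0 xeM].
exists (ball x e, ball x e) => /=; first by split; apply: nbhsx_ballx.
move=> -[y z] /= [xy xz]; set v := y - z.
pose S := \sum_k \sum_l M k l.
have S0 : 0 <= S by do 2!apply: sumr_ge0 => ? _.
have dgS t : 0 <= t <= 1 -> `|'d g (z + t *: v) v| <= S * `|v|.
  move=> /andP[t0 t1].
  have xt : ball x e (z + t *: v).
    move: xy xz; rewrite -!ball_normE /ball_ /= => xy xz.
    have -> : x - (z + t *: v) = (1 - t) *: (x - z) + t *: (x - y).
      rewrite /v; apply/matrixP => i j; rewrite !mxE; ring.
    rewrite (le_lt_trans (ler_normD _ _))// !normrZ (ger0_norm t0).
    rewrite ger0_norm ?subr_ge0//.
    have [t00|t00] := eqVneq t 0.
      by rewrite t00 subr0 mul1r mul0r addr0.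
    have -> : e = (1 - t) * e + t * e by ring.
    apply: ler_ltD; first by rewrite ler_wpM2l ?subr_ge0// ltW.
    by rewrite ltr_pM2l// lt0r t00.
  rewrite [X in 'd g _ X]matrix_sum_delta linear_sum /= mulr_suml.
  apply: (le_trans (ler_norm_sum _ _ _)); apply: ler_sum => k _.
  rewrite linear_sum /= mulr_suml.
  apply: (le_trans (ler_norm_sum _ _ _)); apply: ler_sum => l _.
  rewrite linearZ normrZ mulrC -deriveE//.
  by apply: ler_pM => //; [exact: (xeM _ xt (k, l)) | exact: ler_mx_entry].
apply: mx_norm_le => [|i j]; first by rewrite mulr_ge0.
pose h t := g (z + t *: v).
have dh t : is_diff t h ('d g (z + t *: v) \o ( *:%R ^~ v)).
  have -> : h = g \o (fun t => z + t *: v) by [].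
  have dl : is_diff t (fun t : R => z + t *: v) ( *:%R ^~ v).
    have -> : ( *:%R ^~ v : R -> _) = 0 + ( *:%R ^~ v) by rewrite add0r.
    exact: is_diffD.
  have dg' := differentiableP (dg (z + t *: v)).
  exact: is_diff_comp.
have dhij (t : R) :
    is_derive t 1 (fun t : R => h t i j : R) ('d g (z + t *: v) v i j).
  have dht : derivable h t 1 by apply/derivable1_diffP.
  apply: DeriveDef; first by move/derivable_mxP : dht; exact.
  have := derive_mx dht; rewrite deriveE; last exact/derivable1_diffP.
  by rewrite diff_val /= scale1r => ->; rewrite mxE.
have [t t01] := @MVT_segment R _ _ 0 1 ler01 (fun t _ => dhij t)
  (derivable_within_continuous (fun t _ => @ex_derive _ _ _ _ _ _ _ (dhij t))).
rewrite subr0 mulr1 /h scale1r scale0r addr0 [z + v]addrC subrK => gE.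
rewrite [X in `|X|](_ : _ = g y i j - g z i j); last by rewrite !mxE.
by rewrite gE (le_trans (ler_mx_entry _ _ _))// dgS.
Qed.

End LocallyLipschitz.

(** * Gronwall's inequality *)

Section Gronwall.
Context {R : realType}.

(** The function phi * exp (K t) is nondecreasing and phi * exp (- K t) is
    nonincreasing; the former is used before [t0], the latter after. *)
Lemma gronwall_eq0 (phi dphi : R -> R) (t0 e K : R) :
  (forall t, ball t0 e t -> is_derive t 1 phi (dphi t)) ->
  (forall t, ball t0 e t -> 0 <= phi t) ->
  (forall t, ball t0 e t -> `|dphi t| <= K * phi t) ->
  phi t0 = 0 -> forall t, ball t0 e t -> phi t = 0.
Proof.
move=> dphiP phi0 dphiK phit0 t et.
have e0 : 0 < e by move: et; rewrite /ball /= => /(le_lt_trans _); apply.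
pose u c s := phi s * expR (c * s).
have du c s : ball t0 e s ->
    is_derive s 1 (u c) ((dphi s + c * phi s) * expR (c * s)).
  move=> es; have := dphiP _ es => dphis.
  have dexp : is_derive s 1 (fun s => expR (c * s)) (c * expR (c * s)).
    have dc : is_derive s 1 (fun s : R => c * s) (c * 1).
      by have := is_deriveZ c (is_derive_id s (1 : R)).
    have := is_derive1_comp (is_derive_expR (c * s)) dc.
    by rewrite mulr1 mulrC.
  apply: is_derive_eq; rewrite /GRing.scale/=; ring.
have sub s1 s2 s :
    ball t0 e s1 -> ball t0 e s2 -> s \in `[s1, s2] -> ball t0 e s.
  rewrite /ball /= in_itv/= => s1e s2e /andP[s1s ss2].
  move: s1e s2e; rewrite !ltr_norml => /andP[a1 a2] /andP[b1 b2].
  by apply/andP; split; lra.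
have et0 : ball t0 e t0 by exact: ballxx.
have uc c s1 s2 : ball t0 e s1 -> ball t0 e s2 ->
    {within `[s1, s2], continuous (u c)}.
  move=> h1 h2; apply: derivable_within_continuous => s s12.
  have h := du c s (sub _ _ _ h1 h2 s12).
  exact: ex_derive.
have ioo (s1 s2 s : R) : s \in `]s1, s2[ -> s \in `[s1, s2].
  exact: subset_itv_oo_cc.
suff [c ucE] : exists c, u c t <= 0.
  apply/eqP; rewrite eq_le phi0// andbT.
  by move: ucE; rewrite /u pmulr_lle0// expR_gt0.
have [tt0|t0t] := leP t t0.
- exists K; have -> : 0 = u K t0 by rewrite /u phit0 mul0r.
  apply: (@ger0_derive1_le_cc _ (u K) t t0) => //.
  + move=> s /ioo s12; have h := du K s (sub _ _ _ et et0 s12).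
    exact: ex_derive.
  + move=> s /ioo s12; have es := sub _ _ _ et et0 s12.
    have h := du K s es; rewrite derive1E derive_val.
    rewrite mulr_ge0 ?expR_ge0//.
    by have := dphiK _ es; rewrite ler_norml => /andP[]; lra.
  + exact: uc.
  + by rewrite in_itv/= lexx.
  + by rewrite in_itv/= lexx andbT.
- exists (- K); have -> : 0 = u (- K) t0 by rewrite /u phit0 mul0r.
  apply: (@ler0_derive1_le_cc _ (u (- K)) t0 t) => //; last exact: ltW.
  + move=> s /ioo s12; have h := du (- K) s (sub _ _ _ et0 et s12).
    exact: ex_derive.
  + move=> s /ioo s12; have es := sub _ _ _ et0 et s12.
    have h := du (- K) s es; rewrite derive1E derive_val.
    rewrite mulr_le0_ge0 ?expR_ge0//.
    by have := dphiK _ es; rewrite ler_norml => /andP[]; lra.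
  + exact: uc.
  + by rewrite in_itv/= lexx ltW.
  + by rewrite in_itv/= lexx ltW.
Qed.

Lemma is_derive_mxP {V : normedModType R} {p q : nat} (M : V -> 'M[R]_(p, q))
    (x v : V) (D : 'M[R]_(p, q)) :
  is_derive x v M D <->
  forall i j, is_derive x v (fun y => M y i j : R) (D i j).
Proof.
split=> [dM i j|dM].
  have dMx : derivable M x v by exact: ex_derive.
  apply: DeriveDef; first by move/derivable_mxP : dMx; exact.
  by have /matrixP/(_ i j) := derive_mx dMx; rewrite derive_val mxE => ->.
have dMx : derivable M x v.
  by apply/derivable_mxP => i j; have := dM i j => h; exact: ex_derive.
apply: DeriveDef => //; rewrite derive_mx//; apply/matrixP => i j; rewrite mxE.
by have := dM i j => h; exact: derive_val.
Qed.

(** The scalar inequality is applied to the sum of the squares of the entries,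
    which, unlike the norm, is differentiable. *)
Lemma gronwall_mx_eq0 {p q : nat} (z dz : R -> 'M[R]_(p, q)) (t0 e K : R) :
  (forall t, ball t0 e t -> is_derive t 1 z (dz t)) ->
  (forall t, ball t0 e t -> `|dz t| <= K * `|z t|) ->
  z t0 = 0 -> forall t, ball t0 e t -> z t = 0.
Proof.
move=> dzP dzK zt0.
pose phi t := \sum_i \sum_j z t i j ^+ 2.
have phi0 t : 0 <= phi t by do 2!apply: sumr_ge0 => ? _; exact: sqr_ge0.
have entry t i j : z t i j ^+ 2 <= phi t.
  rewrite /phi (bigD1 i)//= (bigD1 j)//= -addrA lerDl addr_ge0//.
    by apply: sumr_ge0 => ? _; exact: sqr_ge0.
  by do 2!apply: sumr_ge0 => ? _; exact: sqr_ge0.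
have zphi t : `|z t| ^+ 2 <= phi t.
  rewrite -[leRHS]sqr_sqrtr// ler_sqr ?nnegrE ?sqrtr_ge0//.
  apply: mx_norm_le; first exact: sqrtr_ge0.
  by move=> i j; rewrite -sqrtr_sqr ler_sqrt.
pose dphi t := \sum_i \sum_j (2 * z t i j * dz t i j).
suff zero t : ball t0 e t -> phi t = 0.
  move=> t /zero phit; apply/eqP; rewrite -normr_eq0 -sqrf_eq0 eq_le sqr_ge0.
  by rewrite -[X in _ <= X]phit zphi.
move: t.
apply: (@gronwall_eq0 phi dphi t0 e (\sum_(i < p) \sum_(j < q) (2 * `|K|))).
- move=> t /dzP/is_derive_mxP dzt.
  have -> : phi = \sum_i \sum_j (fun t => z t i j) ^+ 2.
    apply/funext => s; rewrite fct_sumE; apply: eq_bigr => i _.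
    by rewrite fct_sumE.
  have dij i j : is_derive t 1 ((fun s : R => z s i j : R) ^+ 2)
      (2 * z t i j * dz t i j).
    have h := dzt i j; apply: is_derive_eq.
    by rewrite /GRing.scale /= expr1 mulr2n; ring.
  by do 2!apply: is_derive_sum => ?; exact: dij.
- by move=> t _; exact: phi0.
- move=> t et; rewrite /dphi mulr_suml.
  apply: (le_trans (ler_norm_sum _ _ _)); apply: ler_sum => i _.
  rewrite mulr_suml.
  apply: (le_trans (ler_norm_sum _ _ _)); apply: ler_sum => j _.
  rewrite !normrM ger0_norm// -!mulrA ler_wpM2l//.
  apply: (@le_trans _ _ (`|z t| * (`|K| * `|z t|))).
    apply: ler_pM => //; first exact: ler_mx_entry.
    rewrite (le_trans (ler_mx_entry _ _ _))// (le_trans (dzK _ et))//.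
    by rewrite ler_wpM2r// ler_norm.
  by rewrite mulrCA -expr2 ler_wpM2l.
- by rewrite /phi zt0; do 2!(apply: big1 => ? _); rewrite mxE expr0n.
Qed.

End Gronwall.

(** * Class representatives of an equivalence relation *)

Section ClassRepr.
Context {T : finType} (r : rel T).
Hypothesis r_equiv : equivalence_rel r.

(** The representative picked in the class of [x]; the default value [x] of
    [odflt] is not used when [r] is an equivalence relation. *)
Definition class_repr (x : T) : T := odflt x [pick y | r x y].

Lemma equiv_refl x : r x x.
Proof. by have [] := r_equiv x x x. Qed.

Lemma equiv_sym x y : r x y = r y x.
Proof.
apply/idP/idP => h.
  by have [_ <-] := r_equiv x y x; rewrite ?equiv_refl.
by have [_ <-] := r_equiv y x y; rewrite ?equiv_refl.
Qed.

Lemma class_reprP x : r x (class_repr x).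
Proof.
by rewrite /class_repr; case: pickP => //= _; exact: equiv_refl.
Qed.

Lemma class_repr_eq x y : (class_repr x == class_repr y) = r x y.
Proof.
apply/eqP/idP => [rxy|rxy].
  have [_ ->] := r_equiv x (class_repr x) y; last exact: class_reprP.
  by rewrite equiv_sym rxy class_reprP.
have rr : r x =1 r y by move=> z; have [_ ->] := r_equiv x y z.
rewrite /class_repr (eq_pick rr); case: pickP => //= /(_ y).
by rewrite equiv_refl.
Qed.

Lemma class_reprK x : class_repr (class_repr x) = class_repr x.
Proof. by apply/eqP; rewrite class_repr_eq equiv_sym class_reprP. Qed.

End ClassRepr.

(** * Flow invariance of polydiagonal subspaces *)

Section FlowInvariance.
Context {R : realType} {N d : nat} (r : rel 'I_N).
Hypothesis r_equiv : equivalence_rel r.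

(* The projection onto the polydiagonal subspace copying the state of the
   representative of each class. *)
Let proj (x : 'M[R]_(N, d)) := rowsub (class_repr r) x.

Lemma polydiag_rowsub (x : 'M[R]_(N, d)) : polydiag r d x <-> proj x = x.
Proof.
split=> [xD|xE i j].
  apply/row_matrixP => i; rewrite row_rowsub; apply/esym/xD.
  exact: class_reprP.
rewrite -(class_repr_eq r_equiv) => /eqP rij.
by rewrite -xE !row_rowsub rij.
Qed.

(** A polydiagonal subspace that a locally Lipschitz vector field maps into
    itself is invariant under its flow. *)
Lemma polydiag_flow_invariant (F : 'M[R]_(N, d) -> 'M[R]_(N, d)) :
  (forall x, locally_lipschitz F x) ->
  (forall x, polydiag r d x -> polydiag r d (F x)) ->
  flow_invariant F (polydiag r d).
Proof.
move=> Flip FD a b x a0 b0 xF xD0.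
have projB y z : proj y - proj z = proj (y - z).
  by apply/matrixP => i j; rewrite !mxE.
have proj_le y : `|proj y| <= `|y|.
  by apply: mx_norm_le => // i j; rewrite mxE ler_mx_entry.
have projD y : polydiag r d (proj y).
  apply/polydiag_rowsub/matrixP => i j; rewrite !mxE.
  by rewrite (class_reprK r_equiv).
pose z t := x t - proj (x t).
pose dz t := F (x t) - proj (F (x t)).
have zD t : polydiag r d (x t) <-> z t = 0.
  rewrite polydiag_rowsub /z; split=> [->|/eqP]; first by rewrite subrr.
  by rewrite subr_eq0 => /eqP.
have dzP t : t \in `]a, b[ -> is_derive t 1 z (dz t).
  move=> /xF/is_derive_mxP xFt; apply/is_derive_mxP => i j.
  have -> : (fun y => z y i j) =
      (fun y => x y i j) - (fun y => x y (class_repr r i) j).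
    by apply/funext => y; rewrite !mxE.
  have -> : dz t i j = F (x t) i j - F (x t) (class_repr r i) j by rewrite !mxE.
  by apply: is_deriveB.
have xc t : t \in `]a, b[ -> {for t, continuous x}.
  move=> /xF xFt; apply/differentiable_continuous/derivable1_diffP.
  exact: ex_derive.
have ab_open t : t \in `]a, b[ -> \forall s \near t, s \in `]a, b[.
  move=> tab; exact: near_in_itvoo.
have z_open t : t \in `]a, b[ -> z t = 0 -> \forall s \near t, z s = 0.
  move=> tab zt0.
  have [k k0 /nbhs_ballP[e /= e0 Fk]] := Flip (x t).
  have := xc t tab => /cvgr_dist_lt/(_ _ e0) xe.
  have [dl /= dl0 tdl] : \forall s \near t, (s \in `]a, b[) /\ `|x t - x s| < e.
    by near=> s; split; near: s; [exact: ab_open|exact: xe].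
  apply/nbhs_ballP; exists dl => //= s.
  move: s; apply: (@gronwall_mx_eq0 _ _ _ z dz t dl (2 * k)) => //.
  - by move=> s /tdl[+ _]; exact: dzP.
  - move=> s /tdl[sab xts].
    (* dz = (id - proj) (F x - F (proj x)), as F (proj x) is a fixed point of
       proj. *)
    have FP : proj (F (proj (x s))) = F (proj (x s)).
      by apply/polydiag_rowsub/FD/projD.
    have -> : dz s = (F (x s) - F (proj (x s)))
        - proj (F (x s) - F (proj (x s))).
      by rewrite /dz -projB FP; apply/matrixP => i j; rewrite !mxE; ring.
    rewrite (le_trans (ler_normB _ _))// -mulrA mulr2n mulrDl mul1r.
    have FxP : `|F (x s) - F (proj (x s))| <= k * `|z s|.
      apply: (Fk (x s, proj (x s))); split; rewrite -ball_normE//=.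
      move/zD : zt0 => /polydiag_rowsub {1}<-; rewrite projB.
      exact: le_lt_trans (proj_le _) _.
    by apply: lerD => //; apply: le_trans FxP; exact: proj_le.
pose A := [set t | (t \in `]a, b[) /\ z t = 0].
have : A = `]a, b[%classic.
  have : connected (`]a, b[%classic : set R).
    by apply/connected_intervalP; exact: interval_is_interval.
  apply.
  - by exists 0; split; [rewrite in_itv/= a0 b0|apply/zD].
  - exists A°; first exact: open_interior.
    apply/seteqP; split=> [t [tab zt]|t [_ /interior_subset]//]; split=> //.
    apply: filterS2 (ab_open _ tab) (z_open _ tab zt) => s sab zs.
    by split.
  - exists (closure A); first exact: closed_closure.
    apply/seteqP; split=> [t tA|t /= [tab clt]].
      by split; [case: tA|exact: subset_closure].
    split => //; apply/eqP; rewrite -normr_eq0; apply/negPn/negP => zt0.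
    have zt2 : 0 < `|z t| / 2 by rewrite divr_gt0// lt0r zt0 normr_ge0.
    have := xc t tab => /cvgr_dist_lt/(_ _ zt2) /clt[s [[sab zs] /= xts]].
    (* z t = (id - proj) (x t - x s), because z s = 0. *)
    have : `|z t| <= `|x t - x s| + `|x t - x s|.
      have -> : z t = (x t - x s) - proj (x t - x s).
        rewrite -[LHS]subr0 -zs /z -projB.
        by apply/matrixP => i j; rewrite !mxE; ring.
      by rewrite (le_trans (ler_normB _ _))// lerD2l.
    apply/negP; rewrite -ltNge; lra.
by move=> /seteqP[_ h] t tab; apply/zD; have [] := h t tab.
Unshelve. all: by end_near. Qed.

End FlowInvariance.

(** * Sums over sequences and base-N expansions *)

Section SeqSums.

Lemma big_seq_count (V : nmodType) (T : finType) (s : seq T) (F : T -> V) :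
  \sum_(x <- s) F x = \sum_x F x *+ count_mem x s.
Proof.
elim: s => [|y s IHs]; first by rewrite big_nil big1.
rewrite big_cons IHs /=; under [RHS]eq_bigr do rewrite mulrnDr.
rewrite big_split/=; congr (_ + _); rewrite (bigD1 y)//= eqxx mulr1n.
by rewrite big1 ?addr0// => x; rewrite eq_sym => /negPf ->; rewrite mulr0n.
Qed.

Lemma base_expansion_inj (K N : nat) (a b : 'I_K -> nat) :
  (forall i, a i < N)%N -> (forall i, b i < N)%N ->
  (\sum_i a i * N ^ i = \sum_i b i * N ^ i)%N -> a =1 b.
Proof.
elim: K a b => [a b _ _ _ []//|K IHK a b aN bN].
rewrite !big_ord_recl /= !expn0 !muln1 => ab.
have shiftE (c : 'I_K.+1 -> nat) :
    (\sum_(i < K) c (lift ord0 i) * N ^ bump 0 i =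
     (\sum_(i < K) c (lift ord0 i) * N ^ i) * N)%N.
  rewrite big_distrl; apply: eq_bigr => i _ /=.
  by rewrite /bump add1n expnSr mulnA.
have N0 : (0 < N)%N by apply: leq_ltn_trans (aN ord0).
move: ab; rewrite !shiftE => ab.
have a0 : a ord0 = b ord0.
  by have /(congr1 (modn^~ N)) := ab; rewrite ![(_ + _ * _)%N]addnC !modnMDl
    !modn_small.
have {}IHK :=
  IHK (a \o lift ord0) (b \o lift ord0) (fun=> aN _) (fun=> bN _).
have /IHK aS : (\sum_(i < K) a (lift ord0 i) * N ^ i =
                \sum_(i < K) b (lift ord0 i) * N ^ i)%N.
  by move: ab; rewrite a0 => /addnI/eqP; rewrite eqn_pmul2r// => /eqP.
move=> i; case: (unliftP ord0 i) => [j ->|->//]; exact: aS.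
Qed.

(** The multiplicities in [s] are the digits of its sum of powers of [N]. *)
Lemma perm_eq_sum_expn (K N : nat) (s s' : seq 'I_K) :
  (size s < N)%N -> (size s' < N)%N ->
  (\sum_(i <- s) N ^ i = \sum_(i <- s') N ^ i)%N -> perm_eq s s'.
Proof.
move=> sN s'N.
have count_sum (t : seq 'I_K) :
    (\sum_(i <- t) N ^ i = \sum_i count_mem i t * N ^ i)%N.
  have := @big_seq_count nat _ t (fun i => (N ^ i)%N).
  rewrite [X in _ = X -> _]
    (eq_bigr (fun i => (count_mem i t * N ^ i)%N)); last first.
    by move=> i _; rewrite -mulr_natr natn mulrC.
  exact.
rewrite !count_sum => /base_expansion_inj ss'.
apply/allP => i _ /=; apply/eqP/ss' => j.
- exact: leq_ltn_trans (count_size _ _) sN.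
- exact: leq_ltn_trans (count_size _ _) s'N.
Qed.

End SeqSums.

(** * Synchrony subspaces of the incidence digraph *)

Section Incidence.
Context {R : realType} {n m : nat} (H : hypergraph n m) (w : 'I_m -> R).

Lemma sum_tail (e : 'I_m) (u : 'I_n -> R) :
  \sum_c tail_mx (R := R) H e c * u c = \sum_(c <- tail H e) u c.
Proof.
rewrite [RHS]big_seq_count; apply: eq_bigr => c _.
by rewrite mxE count_mem_mset mulr_natl.
Qed.

Lemma incidence_mul_cell (x : 'cV[R]_(n + m)) c :
  (incidence_adj H w *m x) (lshift m c) 0 =
  \sum_e weight_mx H w c e * x (rshift n e) 0.
Proof.
rewrite -[x]vsubmxK mul_block_col mul0mx add0r col_mxEu mxE.
by apply: eq_bigr => e _; rewrite col_mxEd.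
Qed.

Lemma incidence_mul_edge (x : 'cV[R]_(n + m)) e :
  (incidence_adj H w *m x) (rshift n e) 0 =
  \sum_c tail_mx H e c * x (lshift m c) 0.
Proof.
rewrite -[x]vsubmxK mul_block_col !mul0mx addr0 col_mxEd mxE.
by apply: eq_bigr => c _; rewrite col_mxEu.
Qed.

(** The witness forgets the pairs of a cell and a hyperedge; it remains an
    equivalence relation. *)
Lemma polydiag_incidence_polydiag (r : rel ('I_n + 'I_m)) :
  equivalence_rel r ->
  exists r' : rel 'I_(n + m),
    equivalence_rel r' /\ polydiag_incidence (R := R) r = polydiag r' 1.
Proof.
move=> r_equiv.
pose is_cell (i : 'I_(n + m)) :=
  if fintype.split i is inl _ then true else false.
pose r' i j :=
  (is_cell i == is_cell j) && r (fintype.split i) (fintype.split j).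
exists r'; split.
  move=> i j k; rewrite /r' eqxx (equiv_refl r_equiv).
  split=> // /andP[/eqP-> rij].
  by have [_ ->] :=
    r_equiv (fintype.split i) (fintype.split j) (fintype.split k).
apply/seteqP; split=> [x [xc xe] i j|x xr].
  rewrite /r' /is_cell => /andP[].
  rewrite -[in row i x](splitK i) -[in row j x](splitK j).
  case: (fintype.split i) (fintype.split j) => [c|e] [c'|e']//= _ rij.
    by apply/rowP => k; rewrite !mxE !ord1; exact: xc.
  by apply/rowP => k; rewrite !mxE !ord1; exact: xe.
have lE c : fintype.split (lshift m c) = inl c by rewrite (unsplitK (inl c)).
have rE e : fintype.split (rshift n e) = inr e by rewrite (unsplitK (inr e)).
split=> i j rij.
  have /xr/rowP/(_ 0) : r' (lshift m i) (lshift m j).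
    by rewrite /r' /is_cell !lE.
  by rewrite !mxE.
have /xr/rowP/(_ 0) : r' (rshift n i) (rshift n j).
  by rewrite /r' /is_cell !rE.
by rewrite !mxE.
Qed.

(** The upper right and lower left blocks of the adjacency matrix give one
    condition each. *)
Lemma incidence_synchronyP (r : rel ('I_n + 'I_m)) : equivalence_rel r ->
  mx_synchrony_subspace (incidence_adj H w) (polydiag_incidence r) <->
  (forall u : 'I_n -> R, (forall c c', r (inl c) (inl c') -> u c = u c') ->
     forall e e', r (inr e) (inr e') ->
     \sum_(c <- tail H e) u c = \sum_(c <- tail H e') u c) /\
  (forall v : 'I_m -> R, (forall e e', r (inr e) (inr e') -> v e = v e') ->
     forall c c', r (inl c) (inl c') ->
     \sum_(e | c \in Defs.head H e) w e * v e =
     \sum_(e | c' \in Defs.head H e) w e * v e).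
Proof.
move=> r_equiv.
have weightE (v : 'I_m -> R) c :
    \sum_e weight_mx H w c e * v e = \sum_(e | c \in Defs.head H e) w e * v e.
  rewrite [RHS]big_mkcond; apply: eq_bigr => e _.
  by rewrite mxE; case: ifP => //; rewrite mul0r.
split=> [[_ KD]|[Tu Wv]].
  split=> [u uc e e' ree'|v ve c c' rcc'].
    pose x : 'cV[R]_(n + m) := col_mx (\col_c u c) 0.
    have xc c : x (lshift m c) 0 = u c by rewrite col_mxEu mxE.
    have [|_ /(_ _ _ ree')] := KD x.
      by split=> [c c' /uc|e1 e2 _]; rewrite ?xc// !col_mxEd !mxE.
    have KxE e0 : (incidence_adj H w *m x) (rshift n e0) 0 =
        \sum_(c <- tail H e0) u c.
      rewrite incidence_mul_edge -sum_tail.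
      by apply: eq_bigr => c _; rewrite xc.
    by rewrite !KxE.
  pose x : 'cV[R]_(n + m) := col_mx 0 (\col_e v e).
  have xe e : x (rshift n e) 0 = v e by rewrite col_mxEd mxE.
  have [|/(_ _ _ rcc') + _] := KD x.
    by split=> [c1 c2 _|e e' /ve]; rewrite ?xe// !col_mxEu !mxE.
  have KxE c0 : (incidence_adj H w *m x) (lshift m c0) 0 =
      \sum_(e | c0 \in Defs.head H e) w e * v e.
    rewrite incidence_mul_cell -weightE.
    by apply: eq_bigr => e _; rewrite xe.
  by rewrite !KxE.
split; first exact: polydiag_incidence_polydiag.
move=> x [xc xe]; split=> [c c' /Wv|e e' /Tu].
  by rewrite !incidence_mul_cell !weightE; apply.
by rewrite !incidence_mul_edge !sum_tail; apply.
Qed.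

End Incidence.

(** * Admissible vector fields on polydiagonal subspaces *)

Section CellVectorField.
Context {R : realType} {n m : nat} (H : hypergraph n m) (w : 'I_m -> R).

(** The sets [BS H k i], for [k] in [B H i], partition the hyperedges whose head
    contains [i]. *)
Lemma sum_BS {V : nmodType} (i : 'I_n) (G : nat -> 'I_m -> V) :
  \sum_(k <- B H i) \sum_(e in BS H k i) G k e =
  \sum_(e | i \in Defs.head H e) G (tail_size H e) e.
Proof.
pose K := (\max_e tail_size H e).+1.
have KP e : tail_size H e \in iota 0 K.
  by rewrite mem_iota add0n ltnS (leq_bigmax e).
rewrite /B big_filter -/K big_mkcond /=.
transitivity (\sum_(k <- iota 0 K) \sum_(e | i \in Defs.head H e)
    if tail_size H e == k then G k e else 0).
  apply: eq_bigr => k _; case: ifPn => [_|/negPn/eqP BS0].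
    by rewrite -big_mkcondr; apply: eq_bigl => e; rewrite !inE.
  rewrite big1// => e ie; case: ifPn => // ek.
  have : e \in BS H k i by rewrite !inE ie.
  by rewrite BS0 inE.
rewrite exchange_big; apply: eq_bigr => e _.
rewrite (bigD1_seq (tail_size H e)) ?iota_uniq//= eqxx big1 ?addr0// => k.
by rewrite eq_sym => /negPf ->.
Qed.

Lemma row_cell_vf {d : nat} (f : 'rV[R]_d -> 'rV[R]_d) (Q : coupling d) x i :
  row i (cell_vf H w f Q x) =
  f (row i x) + \sum_(e | i \in Defs.head H e) w e *:
    Q (tail_size H e) (col_mx (row i x) (tail_states H x i e (tail_size H e))).
Proof. by rewrite rowK (sum_BS i (fun k e => w e *: Q k _)). Qed.

Lemma cell_vf_locally_lipschitz {d : nat} (f : 'rV[R]_d -> 'rV[R]_d)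
    (Q : coupling d) x :
  smooth f -> (forall k, smooth (Q k)) -> locally_lipschitz (cell_vf H w f Q) x.
Proof.
move=> fs Qs; apply: locally_lipschitz_mx => i.
under [X in locally_lipschitz X]eq_fun do rewrite row_cell_vf.
apply: locally_lipschitzD.
  apply: (@locally_lipschitz_comp1 _ _ _ _ f (row i)) => [y z|].
    apply: mx_norm_le => // a b.
    by have := ler_mx_entry (y - z) i b; rewrite !mxE.
  exact: C1_locally_lipschitz.
apply: locally_lipschitz_sum => e; apply: locally_lipschitzZ.
set k := tail_size H e.
apply: (@locally_lipschitz_comp1 _ _ _ _ (Q k)
  (fun y => col_mx (row i y) (tail_states H y i e k))) => [y z|].
  apply: mx_norm_le => // a b; rewrite opp_col_mx add_col_mx.
  case: (split_ordP a) => j ->; rewrite ?col_mxEu ?col_mxEd !mxE.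
    by have := ler_mx_entry (y - z) i b; rewrite !mxE.
  by have := ler_mx_entry (y - z) (nth i (tail H e) j) b; rewrite !mxE.
apply: C1_locally_lipschitz.
exact: (Qs k 1%N).
Qed.

(** On points of the polydiagonal subspace the tail states of [e] and [e'] are
    permutations of each other.  The cells [i] and [i'] are only default
    values. *)
Lemma coupling_tail_states {d : nat} (r : rel 'I_n) (Q : coupling d)
    (x : 'M[R]_(n, d)) (y : 'rV[R]_d) (i i' : 'I_n) (e e' : 'I_m) :
  equivalence_rel r ->
  (forall k (s : 'S_k) (y : 'rV[R]_d) (z : 'M[R]_(k, d)),
     Q k (col_mx y (row_perm s z)) = Q k (col_mx y z)) ->
  polydiag r d x ->
  perm_eq (map (class_repr r) (tail H e)) (map (class_repr r) (tail H e')) ->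
  Q (tail_size H e) (col_mx y (tail_states H x i e (tail_size H e))) =
  Q (tail_size H e') (col_mx y (tail_states H x i' e' (tail_size H e'))).
Proof.
move=> r_equiv Qperm /(polydiag_rowsub r_equiv) xE ee'.
have sz : tail_size H e' = tail_size H e.
  by have := perm_size ee'; rewrite !size_map /tail_size.
rewrite sz; set k := tail_size H e.
pose t := map (class_repr r) (tail H e : seq 'I_n).
pose t' := map (class_repr r) (tail H e' : seq 'I_n).
have tk : size t == k by rewrite size_map.
have t'k : size t' == k by rewrite size_map -/(tail_size H e') sz.
have /tuple_permP[s sE] : perm_eq (Tuple tk) (Tuple t'k) by [].
have repr_row c : row c x = row (class_repr r c) x by rewrite -{1}xE row_rowsub.
rewrite -[in RHS](Qperm k s); congr (Q k (col_mx y _)).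
apply/row_matrixP => a; rewrite rowK.
have -> : row a (row_perm s (tail_states H x i' e' k)) =
    row (s a) (tail_states H x i' e' k) by apply/rowP => b; rewrite !mxE.
rewrite rowK repr_row [RHS]repr_row.
have szt (c : 'I_k) : (c < size (tail H e))%N by [].
have szt' (c : 'I_k) : (c < size (tail H e'))%N.
  by rewrite -/(tail_size H e') sz.
rewrite -(nth_map i i (class_repr r) (szt a)).
rewrite -(nth_map i' i (class_repr r) (szt' (s a))).
have -> : nth i (map (class_repr r) (tail H e)) a = tnth (Tuple t'k) (s a).
  have -> : map (class_repr r) (tail H e) =
      [tuple tnth (Tuple t'k) (s j) | j < k].
    exact: sE.
  by rewrite -tnth_nth tnth_mktuple.
by rewrite (tnth_nth i).
Qed.

(** The tails of [e] and [e'] have the same image, as multisets, in the quotient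
    of the cells by [r]; classes are encoded by their representatives. *)
Definition tail_equiv (r : rel 'I_n) : rel 'I_m := [rel e e' |
  perm_eq (map (class_repr r) (tail H e)) (map (class_repr r) (tail H e'))].

(** If hyperedges related by [q] have equivalent tails, and cells related by [r]
    receive the same weight from each class of [q], then admissible vector
    fields preserve the polydiagonal subspace of [r]. *)
Lemma cell_vf_polydiag {d : nat} (r : rel 'I_n) (q : rel 'I_m)
    (f : 'rV[R]_d -> 'rV[R]_d) (Q : coupling d) (x : 'M[R]_(n, d)) :
  equivalence_rel r -> admissible H Q ->
  (forall e e', q e e' -> tail_equiv r e e') ->
  (forall v : 'I_m -> R, (forall e e', q e e' -> v e = v e') ->
     forall c c', r c c' ->
     \sum_(e | c \in Defs.head H e) w e * v e =
     \sum_(e | c' \in Defs.head H e) w e * v e) ->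
  polydiag r d x -> polydiag r d (cell_vf H w f Q x).
Proof.
move=> r_equiv [_ Qperm _ _] qtail qw xD c c' rcc'.
rewrite !row_cell_vf -(xD _ _ rcc'); congr (_ + _).
apply/rowP => j; rewrite !summxE.
pose v e := Q (tail_size H e)
  (col_mx (row c x) (tail_states H x c e (tail_size H e))) 0 j.
have vE e e' c1 : tail_equiv r e e' -> v e = Q (tail_size H e')
    (col_mx (row c x) (tail_states H x c1 e' (tail_size H e'))) 0 j.
  by move=> ee'; rewrite /v (coupling_tail_states _ c c1 r_equiv Qperm xD ee').
transitivity (\sum_(e | c \in Defs.head H e) w e * v e).
  by apply: eq_bigr => e _; rewrite mxE.
rewrite (qw v _ _ _ rcc'); last by move=> e e' /qtail/(vE e e' c).
by apply: eq_bigr => e _; rewrite mxE (vE e e c')// /tail_equiv/= perm_refl.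
Qed.

(** Test functions that are constant on the classes of [r] detect [tail_equiv]:
    the indicator function of a class counts the tail cells in it. *)
Lemma tail_equiv_sum (r : rel 'I_n) (e e' : 'I_m) : equivalence_rel r ->
  tail_equiv r e e' <->
  (forall u : 'I_n -> R, (forall c c', r c c' -> u c = u c') ->
     \sum_(c <- tail H e) u c = \sum_(c <- tail H e') u c).
Proof.
move=> r_equiv; split=> [ee' u uc|uE].
  have repr_sum e0 : \sum_(c <- tail H e0) u c =
      \sum_(c <- map (class_repr r) (tail H e0)) u c.
    rewrite big_map; apply: eq_bigr => c _; apply: uc; exact: class_reprP.
  by rewrite !repr_sum; exact: perm_big.
apply/allP => c _ /=.
have count_repr e0 :
    (count_mem c (map (class_repr r) (tail H e0)))%:R =
    \sum_(c' <- tail H e0) (class_repr r c' == c)%:R :> R.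
  rewrite -sum1_count big_map big_mkcond natr_sum.
  by apply: eq_bigr => c' _ /=; case: (_ == _).
rewrite -(eqr_nat R) !count_repr; apply/eqP/uE => c1 c2.
by rewrite -(class_repr_eq r_equiv) => /eqP ->.
Qed.

End CellVectorField.

(** * Probing a synchrony subspace by vector fields with affine solutions *)

Section Probe.
Context {R : realType} {n m : nat} (H : hypergraph n m) (w : 'I_m -> R).

(** The directional derivatives of such a map have the same form. *)
Lemma smooth_horner_linear {U : normedModType R} {d : nat}
    (l : {linear U -> R}) (p : {poly R}) (e : 'rV[R]_d) :
  continuous l -> smooth (fun x => p.[l x] *: e).
Proof.
move=> lc k; have dl x : is_diff x l l.
  by apply: DiffDef; [exact: linear_differentiable|exact: diff_lin].
have dp (q : {poly R}) x : is_diff x (fun x => q.[l x] *: e)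
    (fun v => (l v * q^`().[l x]) *: e).
  have dq : is_diff (l x) (horner q) ( *%R^~ q^`().[l x]).
    have dqx := is_derive_poly q (l x).
    have diffq : differentiable (horner q) (l x).
      by apply/derivable1_diffP; exact: ex_derive.
    apply: DiffDef => //; apply/funext => h.
    have -> : h = h *: (1 : R) by rewrite /GRing.scale/= mulr1.
    by rewrite linearZ -deriveE// derive_val /GRing.scale/= mulr1.
  have dql : is_diff x (horner q \o l) (fun v => l v * q^`().[l x]).
    exact: (is_diff_comp (dl x) dq).
  exact: (is_diff_comp dql (is_diff_scalel _ e)).
elim: k p => [|k IHk] p /=.
  move=> x; apply: differentiable_continuous.
  by have h := dp p x; exact: ex_diff.
split=> [x|v]; first by have := dp p x => h; exact: ex_diff.
have -> : 'D_v (fun x => p.[l x] *: e) = (fun x => (l v *: p^`()).[l x] *: e).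
  apply/funext => x; have h := dp p x; rewrite deriveE; last exact: ex_diff.
  by rewrite diff_val hornerZ.
exact: IHk.
Qed.

(** The sum of the first coordinates of the [k] inputs; row 0 of [y], the state
    of the receiving cell, is left out. *)
Definition input_sum (k : nat) (y : 'M[R]_(1 + k, 2)) : R :=
  \sum_(a < k) y (rshift 1 a) ord0.

Lemma input_sum_is_linear k : linear (@input_sum k).
Proof.
move=> a y z; rewrite /input_sum scaler_sumr -big_split.
by apply: eq_bigr => b _; rewrite !mxE.
Qed.

HB.instance Definition _ k :=
  GRing.isLinear.Build R _ _ _ (@input_sum k) (@input_sum_is_linear k).

Lemma continuous_input_sum k : continuous (@input_sum k).
Proof.
apply: continuous_big => [|a _]; first exact: add_continuous.
exact: coord_continuous.
Qed.

(** The coupling with values on the second coordinate axis of R^2 that applies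
    [h] to the sum of the first coordinates of the inputs.  It vanishes at the
    input numbers [k] that do not occur in [H], as admissibility demands. *)
Definition probe (h : {poly R}) : coupling 2 := fun k y =>
  (if in_BH H k then h else 0).[input_sum y] *: delta_mx 0 ord_max.

Lemma in_BH_gt0 k : in_BH H k -> (0 < k)%N.
Proof.
case/existsP => c; rewrite mem_filter => /andP[/finset.set0Pn[e]].
rewrite inE => /andP[_ /eqP <-] _; rewrite /tail_size lt0n size_eq0.
apply: contra (tail_neq0 H e) => /eqP e0.
by apply/mset_eqP => i; rewrite -count_mem_mset -/(tail H e) e0 mset0E.
Qed.

Lemma in_BH_tail_size c e : c \in Defs.head H e -> in_BH H (tail_size H e).
Proof.
move=> ce; apply/existsP; exists c.
rewrite mem_filter mem_iota add0n ltnS (leq_bigmax e) leq0n !andbT.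
by apply/finset.set0Pn; exists e; rewrite inE ce eqxx.
Qed.

Lemma probe_admissible (h : {poly R}) (t : R) :
  h.[t] != 0 -> admissible H (probe h).
Proof.
move=> ht; split=> [k|k s y z|k kB|k /negPf kB].
- exact: smooth_horner_linear (@continuous_input_sum k).
- rewrite /probe /input_sum; congr (_.[_] *: _).
  under eq_bigr do rewrite col_mxEd mxE.
  under [RHS]eq_bigr do rewrite col_mxEd.
  by rewrite [RHS](reindex_inj (@perm_inj _ s)).
- have k0 := in_BH_gt0 kB.
  (* The sum of the inputs is t when each of them is t / k. *)
  move=> /(congr1 (fun F : 'M[R]_(1 + k, 2) -> 'rV[R]_2 =>
    F (const_mx (t / k%:R)) 0 ord_max)).
  rewrite /probe kB /input_sum !mxE.
  under eq_bigr do rewrite mxE.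
  rewrite sumr_const card_ord -[_ *+ _]mulr_natr divfK ?pnatr_eq0 -?lt0n//.
  by rewrite !eqxx mulr1 => /eqP; apply/negP.
- by apply/funext => y; rewrite /probe kB horner0 scale0r.
Qed.

Lemma cell_vf_probe (h : {poly R}) (x : 'M[R]_(n, 2)) c j :
  cell_vf H w (fun=> 0) (probe h) x c j =
  (\sum_(e | c \in Defs.head H e) w e * h.[(\sum_(i <- tail H e) x i ord0)]) *
  (j == ord_max)%:R.
Proof.
have -> : cell_vf H w (fun=> 0) (probe h) x c j =
    row c (cell_vf H w (fun=> 0) (probe h) x) 0 j by rewrite [RHS]mxE.
rewrite row_cell_vf add0r summxE mulr_suml; apply: eq_bigr => e ce.
rewrite /probe (in_BH_tail_size ce) !mxE eqxx /= mulrA; congr (_ * _.[_] * _).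
rewrite /input_sum (big_nth c) big_mkord; apply: eq_bigr => a _.
by rewrite col_mxEd !mxE.
Qed.

(** The affine curve x0 + s F x0 is a solution through x0 = (u, 0), because F
    depends on the first coordinates only and changes the second ones only. *)
Lemma synchrony_probe (r : rel 'I_n) (h : {poly R}) (t : R) (u : 'I_n -> R) :
  synchrony_subspace H w r -> h.[t] != 0 ->
  (forall c c', r c c' -> u c = u c') ->
  forall c c', r c c' ->
  \sum_(e | c \in Defs.head H e) w e * h.[(\sum_(i <- tail H e) u i)] =
  \sum_(e | c' \in Defs.head H e) w e * h.[(\sum_(i <- tail H e) u i)].
Proof.
move=> rsync ht uc c c' rcc'.
pose F := cell_vf H w (fun=> 0) (probe h).
pose x0 : 'M[R]_(n, 2) := \matrix_(i, j) (u i * (j == ord0)%:R).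
pose x (s : R) := x0 + s *: F x0.
have x0E s i : x s i ord0 = u i.
  by rewrite mxE [X in _ + X]mxE /F cell_vf_probe !mulr0 addr0 mxE mulr1.
have Fx s : F (x s) = F x0.
  apply/matrixP => i j; rewrite !cell_vf_probe; congr (_ * _).
  apply: eq_bigr => e _; congr (_ * _.[_]); apply: eq_bigr => i' _.
  by rewrite x0E mxE mulr1.
have x0D : polydiag r 2 x0.
  by move=> i i' rii'; apply/rowP => j; rewrite !mxE (uc _ _ rii').
pose f0 : 'rV[R]_2 -> 'rV[R]_2 := fun=> 0.
have smooth0 : smooth f0.
  elim=> [|k IHk] /=; first exact: cst_continuous.
  split=> [y|v]; first exact: differentiable_cst.
  by have -> : 'D_v f0 = f0 by apply/funext => y; exact: derive_cst.
have xP (s : R) : is_derive s 1 x (F (x s)).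
  rewrite Fx; apply/is_derive_mxP => i j.
  have -> : (fun s0 => x s0 i j) = cst (x0 i j) + (fun s0 => s0 * F x0 i j).
    by apply/funext => s0; rewrite !mxE.
  have dM := is_deriveM (is_derive_id s (1 : R))
    (is_derive_cst (F x0 i j) s (1 : R)).
  apply: is_derive_eq (is_deriveD (is_derive_cst (x0 i j) s (1 : R)) dM) _.
  by rewrite /GRing.scale/= mulr0 mulr1 !add0r.
(* The interval ]-2, 2[ contains time 1, where the solution is x0 + F x0. *)
have := rsync 2%N f0 (probe h) isT smooth0 (probe_admissible ht) (- 2) 2 x.
rewrite oppr_lt0 ltr0n => /(_ isT isT (fun s _ => xP s)).
rewrite {1}/x scale0r addr0 => /(_ x0D 1).
have t1 : 1 \in `](- 2 : R), 2[ by rewrite in_itv/=; lra.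
move=> /(_ t1 _ _ rcc')/rowP/(_ ord_max).
have xE i : row i (x 1) 0 ord_max =
    \sum_(e | i \in Defs.head H e) w e * h.[(\sum_(i <- tail H e) u i)].
  rewrite mxE /x scale1r mxE {1}mxE mulr0 add0r /F cell_vf_probe mulr1.
  apply: eq_bigr => e _; congr (_ * _.[_]); apply: eq_bigr => i' _.
  by rewrite mxE mulr1.
by rewrite !xE.
Qed.

(** Related cells receive the same weight from each class of hyperedges with
    equivalent tails. *)
Lemma synchrony_tail_class (r : rel 'I_n) (e0 : 'I_m) : equivalence_rel r ->
  synchrony_subspace H w r ->
  forall c c', r c c' ->
  \sum_(e | (c \in Defs.head H e) && tail_equiv H r e0 e) w e =
  \sum_(e | (c' \in Defs.head H e) && tail_equiv H r e0 e) w e.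
Proof.
move=> r_equiv rsync c c' rcc'.
(* N exceeds all tail sizes, so that code e determines the class of e. *)
pose N := (\max_e tail_size H e).+1.
pose code e := (\sum_(i <- map (class_repr r) (tail H e)) N ^ i)%N.
have codeP e e' : (code e == code e') = tail_equiv H r e e'.
  apply/eqP/idP => [|ee']; last exact: perm_big.
  by apply: perm_eq_sum_expn; rewrite size_map ltnS -/(tail_size H _)
    (leq_bigmax (_ : 'I_m)).
pose u i : R := (N ^ class_repr r i)%N%:R.
have uc i i' : r i i' -> u i = u i'.
  by rewrite /u -(class_repr_eq r_equiv) => /eqP ->.
have uE e : \sum_(i <- tail H e) u i = (code e)%:R.
  by rewrite /code big_map natr_sum.
pose h : {poly R} := \prod_(e | code e0 != code e) ('X - (code e)%:R%:P).
have hE e : h.[(\sum_(i <- tail H e) u i)] =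
    if tail_equiv H r e0 e then h.[(code e0)%:R] else 0.
  rewrite uE -codeP; case: eqP => [->//|/eqP e0e].
  rewrite /h horner_prod (bigD1 e)//= hornerXsubC subrr mul0r //.
have h0 : h.[(code e0)%:R] != 0.
  rewrite /h horner_prod; apply/prodf_neq0 => e e0e.
  by rewrite hornerXsubC subr_eq0 eqr_nat.
have := synchrony_probe rsync h0 uc rcc'.
have sumE i :
    \sum_(e | i \in Defs.head H e) w e * h.[(\sum_(i <- tail H e) u i)] =
    (\sum_(e | (i \in Defs.head H e) && tail_equiv H r e0 e) w e) *
    h.[(code e0)%:R].
  rewrite mulr_suml [RHS]big_mkcondr; apply: eq_bigr => e _; rewrite hE.
  by case: ifP => //; rewrite mulr0.
by rewrite !sumE => /(mulIf h0).
Qed.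

Lemma tail_equiv_equiv (r : rel 'I_n) : equivalence_rel (tail_equiv H r).
Proof.
move=> e e' e''; split; first exact: perm_refl.
by move=> /permPl ee'; exact: ee'.
Qed.

(** The sum over the hyperedges is split along the classes of [tail_equiv]. *)
Lemma synchrony_weights (r : rel 'I_n) (v : 'I_m -> R) : equivalence_rel r ->
  synchrony_subspace H w r ->
  (forall e e', tail_equiv H r e e' -> v e = v e') ->
  forall c c', r c c' ->
  \sum_(e | c \in Defs.head H e) w e * v e =
  \sum_(e | c' \in Defs.head H e) w e * v e.
Proof.
move=> r_equiv rsync vc c c' rcc'.
have q_equiv := tail_equiv_equiv r.
pose q_repr := class_repr (tail_equiv H r).
have sumE i : \sum_(e | i \in Defs.head H e) w e * v e =
    \sum_e0 (\sum_(e | (i \in Defs.head H e) && tail_equiv H r e0 e) w e) *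
      (v e0 *+ (q_repr e0 == e0)).
  rewrite (partition_big q_repr predT)//=; apply: eq_bigr => e0 _.
  have [e0E|e0E] := eqVneq (q_repr e0) e0; last first.
    rewrite mulr0 big1// => e /andP[_ /eqP ee0].
    by rewrite -ee0 /q_repr (class_reprK q_equiv) eqxx in e0E.
  rewrite mulr1n mulr_suml; apply: eq_big => [e|e /andP[_ /eqP ee0]].
    by rewrite -[e0 in LHS]e0E (class_repr_eq q_equiv) (equiv_sym q_equiv).
  by rewrite -(vc e) // -ee0; exact: class_reprP.
rewrite !sumE; apply: eq_bigr => e0 _.
by rewrite (synchrony_tail_class e0 r_equiv rsync rcc').
Qed.

End Probe.

(** * Synchrony in the hypergraph and in its incidence digraph *)

Theorem theorem4p23 (R : realType) (n m : nat) (H : hypergraph n m)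
    (w : 'I_m -> R) (bowtie : rel 'I_n) :
  weakly_connected H ->
  equivalence_rel bowtie ->
  synchrony_subspace H w bowtie <->
  exists bowtie' : rel ('I_n + 'I_m),
    [/\ equivalence_rel bowtie',
        forall d, polydiag (R := R) bowtie d = polydiag (cell_proj bowtie') d
      & mx_synchrony_subspace (incidence_adj H w) (polydiag_incidence bowtie')].
Proof.
move=> _ r_equiv; split=> [rsync|].
  pose q (i j : 'I_n + 'I_m) := match i, j with
    | inl c, inl c' => bowtie c c'
    | inr e, inr e' => tail_equiv H bowtie e e'
    | _, _ => false
    end.
  have q_equiv : equivalence_rel q.
    by move=> [c|e] [c'|e'] [c''|e'']; split=> //=;
      do ?[exact: equiv_refl | by case: (r_equiv c c' c'') |
           by case: (@tail_equiv_equiv _ _ H bowtie e e' e'') |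
           exact: perm_refl].
  exists q; split=> //; apply/incidence_synchronyP => //; split.
    by move=> u uc e e' /tail_equiv_sum; apply.
  by move=> v vc c c' /(synchrony_weights r_equiv rsync vc).
move=> [q [q_equiv rq /(incidence_synchronyP _ _ q_equiv)[qtail qw]]].
have cq_equiv : equivalence_rel (cell_proj q).
  by move=> c c' c''; exact: q_equiv.
move=> d f Q _ fs QA; rewrite rq.
apply: polydiag_flow_invariant => // x.
  by case: QA => Qs _ _ _; exact: cell_vf_locally_lipschitz.
apply: (cell_vf_polydiag (q := [rel e e' | q (inr e) (inr e')])) => //.
by move=> e e' ee'; apply/tail_equiv_sum => // u uc; exact: qtail.
Qed.
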